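(* Let $d\ge2$ be an integer and suppose that $-1\le\beta<\alpha<1$ and $\beta<0$. If $\frac{\alpha-\beta}{-\beta}<1+\frac{1}{d-1}$, then $$N_{\alpha,\beta}(d)\le\max\left\{d+1,\ \left(\frac{-\alpha}{\alpha-\beta}+d^{-1}\right)^{-1}\frac{1-\beta}{\alpha-\beta}\right\}.$$
   Context: For $-1\le\beta<\alpha<1$, a spherical $\{\alpha,\beta\}$-code in $\mathbb{R}^d$ is a set $S$ of unit vectors in $\mathbb{R}^d$ such that $x^\top y\in\{\alpha,\beta\}$ for any two distinct $x,y\in S$ (it is allowed that only one of the values occurs), and $N_{\alpha,\beta}(d)$ is the maximum size of such a code. *)

(* Defs.v *)
From mathcomp Require Import all_boot all_order all_algebra.
From mathcomp Require Import all_classical all_reals.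
From mathcomp Require Import ereal measure.

Set Implicit Arguments.
Unset Strict Implicit.
Unset Printing Implicit Defensive.

Import Order.TTheory GRing.Theory Num.Theory.
Local Open Scope classical_set_scope.
Local Open Scope ring_scope.

Definition dotp (R : realType) (d : nat) (x y : 'cV[R]_d) : R :=
  (x^T *m y) 0 0.

(* The library's norm [`|x|] on matrices is the sup norm, hence this one. *)
Definition enorm (R : realType) (d : nat) (x : 'cV[R]_d) : R :=
  Num.sqrt (dotp x x).

(* No finiteness is imposed on S. *)
Definition spherical_code (R : realType) (alpha beta : R) (d : nat)
    (S : set 'cV[R]_d) : Prop :=
  (forall x, S x -> enorm x = 1) /\
  (forall x y, S x -> S y -> x <> y -> dotp x y = alpha \/ dotp x y = beta).

(* [counting S] is the number of elements of S, or +oo when S is infinite.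
   The supremum is a maximum whenever it is finite, see [max_codeP]. *)
Definition max_code (R : realType) (alpha beta : R) (d : nat) : \bar R :=
  ereal_sup [set counting S | S in @spherical_code R alpha beta d].

Lemma max_codeP (R : realType) (alpha beta : R) (d : nat) :
  (max_code alpha beta d < +oo)%E ->
  exists2 S, @spherical_code R alpha beta d S &
    counting S = max_code alpha beta d.
Proof.
move=> Noo; set N := max_code alpha beta d in Noo *.
have cntE (S : set 'cV[R]_d) :
    (counting S = +oo :> \bar R)%E \/ exists n, counting S = n%:R%:E :> \bar R.
  by rewrite /counting; case: ifP => _; [right; eexists | left].
have ubN S : @spherical_code R alpha beta d S -> (counting S <= N)%E.
  by move=> cS; apply: ereal_sup_ubound; exists S.
have cN S : @spherical_code R alpha beta d S ->
    exists n, counting S = n%:R%:E :> \bar R.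
  move=> cS; case: (cntE S) => // Soo; have := ubN S cS.
  by rewrite Soo leNgt Noo.
have c0 : @spherical_code R alpha beta d set0 by split.
have N0 : (0 <= N)%E.
  apply: le_trans (ubN _ c0); case: (cN _ c0) => n ->.
  by rewrite lee_fin ler0n.
have Nfin : N \is a fin_num by rewrite ge0_fin_numE.
have [_ [S cS <-] ltS] := ub_ereal_sup_adherent (ltr01 : 0 < 1 :> R) Nfin.
exists S => //; apply/eqP; rewrite eq_le ubN //=.
apply: ge_ereal_sup => _ [S' cS' <-].
move: ltS; rewrite lteBlDr// => ltS.
have := le_lt_trans (ubN _ cS') ltS.
have [n ->] := cN _ cS; have [m ->] := cN _ cS'.
by rewrite -EFinD lte_fin lee_fin natr1 ltr_nat ltnS ler_nat.
Qed.

(* Main.v *)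
(** Write [n] for the size of the code and [s = alpha - beta]; the hypothesis
    says [d alpha < s], and the second term of the maximum is at least [n] iff
    [n (s - d alpha) <= d (1 - beta)].  If [alpha < 0] the vectors are pairwise
    obtuse, so [n <= d + 1].  If [alpha >= 0] and [s <= 1], the linear
    programming bound for [(t - alpha) (t - beta)] suffices.  If [s > 1],
    consider the graph of the pairs with inner product [beta]: positivity of
    Gram matrices shows that it has no triangle, no induced pair of disjoint
    edges, and no independent set of more than [d] vertices.  The
    neighbourhoods of both ends of an edge [ij] are thus independent, and so
    is the set of the vertices adjacent to neither end, even with [i] added.
    This gives [n <= d + 1] if
    [ij] is a component, and otherwise [n <= 3 d] together with
    [2 beta^2 <= 1 + alpha] (from a path with two edges), which is enough. *)
Require Import Defs.
From mathcomp Require Import all_boot all_order all_algebra.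
From mathcomp Require Import all_classical all_reals.
From mathcomp Require Import ereal measure.
From mathcomp Require Import finmap ring lra.

Import Order.TTheory GRing.Theory Num.Theory.
Local Open Scope ring_scope.

(** * Inner products, linear relations, and the obtuse and Welch bounds *)

Section DotProduct.
Context {R : realType} {d : nat}.
Implicit Types (x y z : 'cV[R]_d) (a : R).

Lemma dotpE x y : dotp x y = \sum_k x k 0 * y k 0.
Proof. by rewrite /dotp mxE; apply: eq_bigr => k _; rewrite mxE. Qed.

Lemma dotpC x y : dotp x y = dotp y x.
Proof. by rewrite !dotpE; apply: eq_bigr => k _; rewrite mulrC. Qed.

Lemma dotpDl x y z : dotp (x + y) z = dotp x z + dotp y z.
Proof. by rewrite /dotp linearD mulmxDl mxE. Qed.

Lemma dotpZl a x y : dotp (a *: x) y = a * dotp x y.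
Proof. by rewrite /dotp linearZ -scalemxAl mxE. Qed.

Lemma dotpDr x y z : dotp x (y + z) = dotp x y + dotp x z.
Proof. by rewrite dotpC dotpDl !(dotpC x). Qed.

Lemma dotpZr a x y : dotp x (a *: y) = a * dotp x y.
Proof. by rewrite dotpC dotpZl dotpC. Qed.

Lemma dotp0l y : dotp 0 y = 0.
Proof. by rewrite -(scale0r 0) dotpZl mul0r. Qed.

Lemma dotp_suml (I : finType) (P : pred I) (x : I -> 'cV[R]_d) y :
  dotp (\sum_(i | P i) x i) y = \sum_(i | P i) dotp (x i) y.
Proof.
by elim/big_rec2: _ => [|i u v _ <-]; rewrite ?dotp0l ?dotpDl.
Qed.

Lemma dotp_sumr (I : finType) (P : pred I) (x : I -> 'cV[R]_d) y :
  dotp y (\sum_(i | P i) x i) = \sum_(i | P i) dotp y (x i).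
Proof. by rewrite dotpC dotp_suml; apply: eq_bigr => i _; rewrite dotpC. Qed.

Lemma dotpp_ge0 x : 0 <= dotp x x.
Proof. by rewrite dotpE sumr_ge0// => k _; rewrite -expr2 sqr_ge0. Qed.

Lemma dotpp_le0 x : dotp x x <= 0 -> x = 0.
Proof.
move=> x0; have /eqP : dotp x x = 0 by apply/eqP; rewrite eq_le x0 dotpp_ge0.
rewrite dotpE psumr_eq0 => [|k _]; last by rewrite -expr2 sqr_ge0.
move=> /allP xx0; apply/colP => k; rewrite mxE; apply/eqP.
by have := xx0 k (mem_index_enum k); rewrite mulf_eq0 orbb.
Qed.

(** The coefficients form a left kernel vector of the matrix whose rows are the [x i] with [i] in
    [A]; extending it by zero lets sums run over all of [I]. *)
Lemma linear_dependence (I : finType) (x : I -> 'cV[R]_d) (A : {set I}) :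
  (d < #|A|)%N ->
  exists c : I -> R, [/\ exists i, c i != 0, forall i, i \notin A -> c i = 0 &
    \sum_i c i *: x i = 0].
Proof.
move=> dA; pose M : 'M[R]_(#|A|, d) := \matrix_(k, j) x (enum_val k) j 0.
have : kermx M != 0.
  rewrite kermx_eq0 /row_free; apply: contraTneq dA => rM.
  by rewrite -leqNgt -rM rank_leq_col.
move=> /rowV0Pn[u /sub_kermxP uM0 u0].
exists (fun i => \sum_(k | enum_val k == i) u 0 k); split.
- move: u0; case/rV0Pn => k uk; exists (enum_val k).
  rewrite (eq_bigl (pred1 k)) ?big_pred1_eq// => j.
  by rewrite /= (inj_eq enum_val_inj).
- move=> i iA; rewrite big1// => k /eqP ki.
  by have := enum_valP k; rewrite ki (negbTE iA).
- transitivity (\sum_k u 0 k *: x (enum_val k)).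
    rewrite [RHS](partition_big (fun k : 'I_#|A| => enum_val k) predT)//=.
    by apply: eq_bigr => i _; rewrite scaler_suml; apply: eq_bigr => k /eqP <-.
  apply/colP => j; have /rowP/(_ j) := uM0; rewrite !mxE summxE => uMj.
  rewrite -[RHS]uMj.
  by apply: eq_bigr => k _; rewrite !mxE.
Qed.

Lemma obtuse_card (I : finType) (x : I -> 'cV[R]_d) :
  (forall i j, i != j -> dotp (x i) (x j) < 0) -> (#|I| <= d.+1)%N.
Proof.
move=> obt; rewrite leqNgt; apply/negP => dI.
have /card_gt0P[z _] : (0 < #|I|)%N by apply: leq_trans dI.
(* Leaving out [z] still leaves enough vectors for a relation, and keeps [x z] as a test vector
   outside it. *)
have dz : (d < #|[set~ z]|)%N by rewrite cardsC1; case: #|I| dI.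
have [c [[i0 ci0] cA c0]] := linear_dependence _ x _ dz.
(* The positive and the negative part of the relation are opposite vectors with
   nonnegative inner product, so both vanish; but the positive part has negative
   inner product with [x z]. *)
have signed_part (e : I -> R) : (forall i, e i = c i \/ e i = - c i) ->
    \sum_i e i *: x i = 0 -> forall i, e i <= 0.
  move=> ec e0.
  have ez : e z = 0 by case: (ec z) => ->; rewrite cA ?oppr0// !inE eqxx.
  have posE : \sum_(i | 0 < e i) e i *: x i =
      - \sum_(i | ~~ (0 < e i)) e i *: x i.
    by apply/eqP; rewrite -addr_eq0 -(bigID (fun i => 0 < e i) predT) e0.
  have pos0 : \sum_(i | 0 < e i) e i *: x i = 0.
    apply: dotpp_le0; rewrite [X in dotp _ X]posE -scaleN1r dotpZr.
    rewrite mulN1r oppr_le0.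
    rewrite dotp_suml sumr_ge0// => i ei; rewrite dotp_sumr sumr_ge0// => j ej.
    rewrite dotpZl dotpZr mulr_ge0 ?(ltW ei)//.
    rewrite -leNgt in ej; rewrite mulr_le0// ltW// obt//.
    by apply: contraTneq ei => ->; rewrite -leNgt.
  move=> i; rewrite leNgt; apply/negP => ei.
  have : dotp (\sum_(i | 0 < e i) e i *: x i) (x z) < 0.
    have dotz j : 0 < e j -> e j * dotp (x j) (x z) < 0.
      move=> ej; rewrite pmulr_rlt0// obt//.
      by apply: contraTneq ej => ->; rewrite ez ltxx.
    rewrite dotp_suml (bigD1 i)//= ltr_wnDr// ?dotpZl ?dotz//.
    by apply: sumr_le0 => j /andP[ej _]; rewrite dotpZl ltW// dotz.
  by rewrite pos0 dotp0l ltxx.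
have cle := signed_part c (fun i => or_introl erefl) c0.
have cge : forall i, - c i <= 0.
  apply: signed_part => [i|]; first by right.
  by under eq_bigr do rewrite scaleNr; rewrite sumrN c0 oppr0.
move: ci0; rewrite neq_lt ltNge -oppr_le0 cge /=.
by rewrite ltNge cle.
Qed.

(** Cauchy-Schwarz against the all-ones vector, from the sum of all squared differences. *)
Lemma sqr_sum_le (J : finType) (a : J -> R) :
  (\sum_j a j) ^+ 2 <= #|J|%:R * \sum_j a j ^+ 2.
Proof.
have : 0 <= \sum_i \sum_j (a i - a j) ^+ 2.
  by apply: sumr_ge0 => i _; apply: sumr_ge0 => j _; rewrite sqr_ge0.
have -> : \sum_i \sum_j (a i - a j) ^+ 2 =
    #|J|%:R * (\sum_j a j ^+ 2) *+ 2 - (\sum_j a j) ^+ 2 *+ 2.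
  transitivity (\sum_i (a i ^+ 2 * #|J|%:R + \sum_j a j ^+ 2
      - 2 * a i * \sum_j a j)).
    apply: eq_bigr => i _; rewrite mulr_sumr mulr_natr -sumr_const -big_split.
    by rewrite -sumrB; apply: eq_bigr => j _ /=; ring.
  rewrite sumrB big_split /= sumr_const -!mulr_suml -mulr_sumr -mulr_natl.
  by ring.
lra.
Qed.

(** The frame operator [W] has trace [#|I|] and the same Frobenius norm as the Gram matrix;
    Cauchy-Schwarz is applied to its [d] diagonal entries. *)
Lemma welch_bound (I : finType) (x : I -> 'cV[R]_d) :
  (forall i, dotp (x i) (x i) = 1) ->
  #|I|%:R ^+ 2 <= d%:R * \sum_i \sum_j dotp (x i) (x j) ^+ 2.
Proof.
move=> x1; pose W k l : R := \sum_i x i k 0 * x i l 0.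
have -> : #|I|%:R = \sum_k W k k.
  rewrite exchange_big /= -sum1_card natr_sum; apply: eq_bigr => i _.
  by rewrite -dotpE x1.
have -> : \sum_i \sum_j dotp (x i) (x j) ^+ 2 = \sum_k \sum_l W k l ^+ 2.
  transitivity (\sum_k \sum_l \sum_i \sum_j
      (x i k 0 * x j k 0) * (x i l 0 * x j l 0)).
    under [RHS]eq_bigr do rewrite exchange_big.
    rewrite [RHS]exchange_big; apply: eq_bigr => i _ /=.
    under [RHS]eq_bigr do rewrite exchange_big.
    rewrite [RHS]exchange_big; apply: eq_bigr => j _ /=.
    rewrite dotpE expr2 mulr_suml; apply: eq_bigr => k _.
    by rewrite mulr_sumr; apply: eq_bigr.
  apply: eq_bigr => k _; apply: eq_bigr => l _.
  rewrite expr2 mulr_suml; apply: eq_bigr => i _.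
  by rewrite mulr_sumr; apply: eq_bigr => j _; ring.
apply: (le_trans (sqr_sum_le _ _)); rewrite card_ord.
rewrite ler_wpM2l// ler_sum// => k _.
by rewrite (bigD1 k)//= ler_wpDr// sumr_ge0// => l _; rewrite sqr_ge0.
Qed.

End DotProduct.

(** * Cardinality bounds for two-distance codes *)

Section TwoDistance.
Context {R : realType} {d : nat} {alpha beta : R} {I : finType}.
Variable x : I -> 'cV[R]_d.
Hypothesis x1 : forall i, dotp (x i) (x i) = 1.
Hypothesis xab : forall i j, i != j ->
  dotp (x i) (x j) = alpha \/ dotp (x i) (x j) = beta.

(* Delsarte's linear programming bound for the polynomial
   [(t - alpha) (t - beta)], in which [- (alpha + beta)] is the coefficient
   of degree 1. *)
Lemma lp_bound : alpha <= 1 -> beta <= 1 -> alpha + beta <= 0 ->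
  #|I|%:R * (1 + d%:R * (alpha * beta)) <= d%:R * ((1 - alpha) * (1 - beta)).
Proof.
move=> a1 b1 ab0; have [->|n0] := posnP #|I|.
  by rewrite mul0r !mulr_ge0// subr_ge0.
set n : R := #|I|%:R; have {}n0 : 0 < n by rewrite ltr0n.
have sum1 : 0 <= \sum_i \sum_j dotp (x i) (x j).
  have := dotpp_ge0 (\sum_i x i); rewrite dotp_suml.
  by under eq_bigr do rewrite dotp_sumr.
have sum2 := welch_bound _ x x1.
(* The polynomial vanishes at all off-diagonal inner products, so only the [n] diagonal terms
   survive. *)
have sumf : \sum_i \sum_j (dotp (x i) (x j) - alpha) * (dotp (x i) (x j) - beta)
    = n * ((1 - alpha) * (1 - beta)).
  rewrite mulr_natl -sumr_const; apply: eq_bigr => i _.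
  rewrite (bigD1 i)//= x1 big1 ?addr0// => j ji.
  by have [->|->] := xab i j (contra_neq esym ji); rewrite subrr ?mul0r ?mulr0.
have {sumf} sumf : \sum_i \sum_j dotp (x i) (x j) ^+ 2
    - (alpha + beta) * (\sum_i \sum_j dotp (x i) (x j)) + n ^+ 2 * (alpha * beta)
    = n * ((1 - alpha) * (1 - beta)).
  rewrite -sumf mulr_sumr -sumrB expr2 -mulrA mulr_natl -sumr_const -big_split.
  apply: eq_bigr => i _ /=.
  rewrite mulr_sumr -sumrB mulr_natl -sumr_const -big_split.
  by apply: eq_bigr => j _ /=; ring.
rewrite -(ler_pM2l n0).
move: sum1 sum2 sumf; rewrite -/n.
move: (\sum_i _) => S1; move: (\sum_i _) => S2 sum1 sum2 sumf.
have D0 : (0 : R) <= d%:R by [].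
have : 0 <= d%:R * (- (alpha + beta) * S1).
  by rewrite !mulr_ge0// oppr_ge0.
have -> : n * (d%:R * ((1 - alpha) * (1 - beta))) =
   d%:R * (n * ((1 - alpha) * (1 - beta))) by ring.
rewrite -sumf; lra.
Qed.

(** The Gram matrix is [1 - alpha] times the identity plus [alpha] times the all-ones matrix, hence
    positive definite, so the vectors are independent. *)
Lemma alpha_clique_card (A : {set I}) : 0 <= alpha -> alpha < 1 ->
  (forall i j, i \in A -> j \in A -> i != j -> dotp (x i) (x j) = alpha) ->
  (#|A| <= d)%N.
Proof.
move=> a0 a1 cA; rewrite leqNgt; apply/negP => dA.
have [c [[i0 ci0] cN c0]] := linear_dependence _ x A dA.
set C := \sum_i c i.
have row0 i : i \in A -> (1 - alpha) * c i + alpha * C = 0.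
  move=> iA; have : dotp (\sum_j c j *: x j) (x i) = 0 by rewrite c0 dotp0l.
  rewrite dotp_suml => rel; rewrite -[RHS]rel /C (bigD1 i)//= [RHS](bigD1 i)//=.
  rewrite mulrDr dotpZl x1 mulr_sumr.
  rewrite addrA; congr (_ + _); first by ring.
  apply: eq_bigr => j ji; rewrite dotpZl.
  have [jA|/cN ->] := boolP (j \in A); last by rewrite !(mulr0, mul0r).
  by rewrite cA// mulrC.
have : \sum_i c i * ((1 - alpha) * c i + alpha * C) = 0.
  rewrite big1// => i _; have [iA|/cN ->] := boolP (i \in A);
    last by rewrite mul0r.
  by rewrite row0// mulr0.
have -> : \sum_i c i * ((1 - alpha) * c i + alpha * C) =
    (1 - alpha) * (\sum_i c i ^+ 2) + alpha * C ^+ 2.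
  have -> : alpha * C ^+ 2 = \sum_i c i * (alpha * C).
    by rewrite -mulr_suml -/C; ring.
  rewrite [(1 - alpha) * \sum_i _]mulr_sumr -big_split.
  by apply: eq_bigr => i _ /=; ring.
apply/eqP/lt0r_neq0/ltr_wpDr; first by rewrite mulr_ge0 ?sqr_ge0.
apply: mulr_gt0; first by rewrite subr_gt0.
rewrite (bigD1 i0)//=; apply: ltr_wpDr; last by rewrite exprn_even_gt0.
by apply: sumr_ge0 => i _; rewrite sqr_ge0.
Qed.

(** * The graph of inner product [beta] when [alpha - beta > 1] *)

Section LargeGap.
Hypotheses (a0 : 0 < alpha) (a1 : alpha < 1) (ab : alpha < - beta).
Hypothesis (gap : 1 < alpha - beta).

Let e i j := (i != j) && (dotp (x i) (x j) == beta).

Let e_sym i j : e i j = e j i.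
Proof. by rewrite /e eq_sym dotpC. Qed.

Let eP i j : e i j -> dotp (x i) (x j) = beta.
Proof. by case/andP => _ /eqP. Qed.

Let neP i j : i != j -> ~~ e i j -> dotp (x i) (x j) = alpha.
Proof.
by move=> ij; rewrite /e ij /=; have [->|->] := xab _ _ ij; rewrite ?eqxx.
Qed.

Let no_triangle i j k : e i j -> e i k -> ~~ e j k.
Proof.
move=> /eP ij /eP ik; apply/negP => /eP jk.
(* The squared norm is [3 + 6 beta], while [ab] and [gap] give [beta < -1/2]. *)
have := dotpp_ge0 (x i + x j + x k); rewrite !(dotpDl, dotpDr) !x1.
rewrite (dotpC (x j) (x i)) (dotpC (x k) (x i)) (dotpC (x k) (x j)).
by rewrite ij ik jk; apply/negP; rewrite -ltNge; move: ab gap; lra.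
Qed.

Let no_2K2 i j k l : e i j -> e k l ->
  dotp (x i) (x k) = alpha -> dotp (x i) (x l) = alpha ->
  dotp (x j) (x k) = alpha -> dotp (x j) (x l) = alpha -> False.
Proof.
move=> /eP ij /eP kl ik il jk jl.
(* The squared norm is [4 + 4 beta - 8 alpha], which is below [- 4 alpha] by [gap]. *)
have := dotpp_ge0 (x i + x j + (-1) *: x k + (-1) *: x l).
rewrite !(dotpDl, dotpDr, dotpZl, dotpZr) !x1.
rewrite (dotpC (x j) (x i)) (dotpC (x k) (x i)) (dotpC (x k) (x j)).
rewrite (dotpC (x l) (x i)) (dotpC (x l) (x j)) (dotpC (x l) (x k)).
by rewrite ij kl ik il jk jl; apply/negP; rewrite -ltNge; move: a0 gap; lra.
Qed.

Let path_bound i j k : e i j -> e i k -> j != k -> 2 * beta ^+ 2 <= 1 + alpha.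
Proof.
move=> eij eik jk; have jkN := no_triangle _ _ _ eij eik.
(* This vector is [x j + x k] minus its projection on [x i]. *)
have := dotpp_ge0 (x j + x k + (- (2 * beta)) *: x i).
rewrite !(dotpDl, dotpDr, dotpZl, dotpZr) !x1.
rewrite (dotpC (x j) (x i)) (dotpC (x k) (x i)) (dotpC (x k) (x j)).
by rewrite (eP _ _ eij) (eP _ _ eik) (neP _ _ jk jkN); nra.
Qed.

Let nbhd_card i : (#|[set j | e i j]| <= d)%N.
Proof.
apply: alpha_clique_card => //; first exact: ltW.
by move=> j k; rewrite !inE => ij ik jk; rewrite neP// (no_triangle i).
Qed.

(** An edge inside the set would be disjoint from [ij] with no edge between them. The inequality is
    strict because [i], adjacent to [j], is outside the set and can be added. *)
Let nonnbhd_card i j : e i j -> (#|[set k | ~~ e i k && ~~ e j k]| < d)%N.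
Proof.
move=> eij; have ij : i != j by case/andP: eij.
set C := [set k | _].
have iC : i \notin C by rewrite inE [e j i]e_sym eij andbF.
suff : (#|i |: C| <= d)%N by rewrite cardsU1 iC.
have Ci k : k \in C -> dotp (x i) (x k) = alpha /\ dotp (x j) (x k) = alpha.
  rewrite inE => /andP[ik jk]; split; apply: neP => //.
    by apply: contraNneq jk => <-; rewrite e_sym.
  by apply: contraNneq ik => <-.
apply: alpha_clique_card => //; first exact: ltW.
move=> k l; rewrite !in_setU1.
case: (eqVneq k i) => [->|ki] /=; case: (eqVneq l i) => [->|li] /=.
- by [].
- by move=> _ /Ci[].
- by move=> /Ci[? _]; rewrite dotpC.
move=> /Ci[ik jk] /Ci[il jl] kl; apply: neP => //; apply/negP => ekl.
exact: (no_2K2 _ _ _ _ eij ekl).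
Qed.

Lemma large_gap_card : (2 <= d)%N ->
  (#|I| <= d.+1)%N \/ (#|I| <= 3 * d)%N /\ 2 * beta ^+ 2 <= 1 + alpha.
Proof.
move=> d2.
have [/existsP[i /existsP[j eij]]|noe] := boolP [exists i, exists j, e i j];
  last first.
  left; rewrite -cardsT leqW// alpha_clique_card//; first exact: ltW.
  move=> i j _ _ ij; apply: neP => //.
  by apply: contra noe => eij; apply/existsP; exists i; apply/existsP; exists j.
have cover : (#|I| <= #|[set k | e i k]| + #|[set k | e j k]|
    + #|[set k | ~~ e i k && ~~ e j k]|)%N.
  rewrite -cardsT; apply: leq_trans (leq_add (leq_card_setU _ _).1 (leqnn _)).
  apply: leq_trans (leq_card_setU _ _).1; apply: subset_leq_card.
  by apply/fintype.subsetP => k _; rewrite !inE; case: (e i k); case: (e j k).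
have Cd := nonnbhd_card _ _ eij.
have [lei|] := leqP #|[set k | e i k]| 1; last first.
  case/card_gt1P => k [l [ik il kl]]; rewrite !inE in ik il; right; split.
    rewrite (leq_trans cover)// !mulSn mul0n addn0 addnA.
    by rewrite !leq_add// ?nbhd_card// ltnW.
  exact: path_bound ik il kl.
have [lej|] := leqP #|[set k | e j k]| 1; last first.
  case/card_gt1P => k [l [jk jl kl]]; rewrite !inE in jk jl; right; split.
    rewrite (leq_trans cover)// !mulSn mul0n addn0 addnA.
    by rewrite !leq_add// ?nbhd_card// ltnW.
  exact: path_bound jk jl kl.
(* Here [ij] is a component, and the count is [1 + 1 + (d - 1)]. *)
left; apply: (leq_trans cover).
by rewrite (leq_trans (leq_add (leq_add lei lej) (leqnn _))).
Qed.

End LargeGap.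

Lemma code_card : (2 <= d)%N -> -1 <= beta -> beta < 0 -> alpha < 1 ->
  d%:R * alpha < alpha - beta ->
  (#|I| <= d.+1)%N \/
  #|I|%:R * (alpha - beta - d%:R * alpha) <= d%:R * (1 - beta).
Proof.
move=> d2 b1 b0 a1 da; have D2 : (2 : R) <= d%:R by rewrite ler_nat.
have [an|ap] := ltP alpha 0.
  left; apply: (@obtuse_card _ _ _ x) => i j ij.
  by case: (xab _ _ ij) => ->.
(* From [2 alpha <= d alpha < alpha - beta]. *)
have ab : alpha < - beta by nra.
have [gap|gap] := leP (alpha - beta) 1.
  right; have a1' : 0 < 1 - alpha by lra.
  rewrite -(ler_pM2l a1').
  have lp : #|I|%:R * (1 + d%:R * (alpha * beta)) <=
      d%:R * ((1 - alpha) * (1 - beta)) by apply: lp_bound; lra.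
  have -> : (1 - alpha) * (d%:R * (1 - beta)) = d%:R * ((1 - alpha) * (1 - beta)).
    by ring.
  apply: le_trans lp; rewrite mulrCA ler_wpM2l//.
  (* With [s = alpha - beta], right side minus left side is [(1 - s) (1 + d alpha) + alpha s]. *)
  have : 0 <= d%:R * alpha * (1 - (alpha - beta)).
    by rewrite !mulr_ge0// subr_ge0.
  have : alpha * (1 - (alpha - beta)) >= 0 by rewrite mulr_ge0// subr_ge0.
  nra.
have a0 : 0 < alpha by lra.
have [|[n3d path]] := large_gap_card a0 a1 ab gap d2; first by left.
right; have n3d' : #|I|%:R <= 3 * d%:R :> R by rewrite -natrM ler_nat.
have key : 3 * (alpha - beta - d%:R * alpha) <= 1 - beta.
  have : 3 * (- beta - alpha) <= 1 - beta.
    (* The negation says [- 2 beta > 1 + 3 alpha]; squared and compared with [path], it gives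
       [9 alpha^2 + 4 alpha < 1], so [alpha < 1/5]. But [gap] and [path] give
       [2 alpha^2 - 5 alpha + 1 < 0], which fails for such [alpha]. *)
    rewrite leNgt; apply/negP => lt.
    have a5 : alpha < 1/5 by nra.
    nra.
  nra.
apply: (le_trans (ler_wpM2r _ n3d')); first by lra.
by rewrite mulrAC mulrC ler_wpM2l.
Qed.

End TwoDistance.

Theorem theorem5p3 (R : realType) (d : nat) (alpha beta : R)
    (hd : (2 <= d)%N)
    (hbeta1 : -1 <= beta) (hab : beta < alpha) (halpha1 : alpha < 1)
    (hbeta0 : beta < 0)
    (hlt : (alpha - beta) / (- beta) < 1 + 1 / (d%:R - 1)) :
  (max_code alpha beta d <=
   (Num.max (d%:R + 1)
      ((- alpha / (alpha - beta) + d%:R^-1)^-1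
         * ((1 - beta) / (alpha - beta))))%:E)%E.
Proof.
have D2 : (2 : R) <= d%:R by rewrite ler_nat.
have s0 : 0 < alpha - beta by lra.
have da : d%:R * alpha < alpha - beta.
  move: hlt; rewrite ltr_pdivrMr ?oppr_gt0// => hlt.
  have D1 : 0 < d%:R - 1 :> R by lra.
  move: hlt; rewrite -(ltr_pM2l D1).
  have -> : (d%:R - 1) * ((1 + 1 / (d%:R - 1)) * - beta) = - (d%:R * beta).
    by field; lra.
  lra.
set B := Num.max _ _.
(* Bounding all finite subsets of a code also rules out infinite codes. *)
have fset_le (S : set 'cV[R]_d) (F : {fset 'cV[R]_d}) :
    @spherical_code R alpha beta d S -> (forall x, x \in F -> S x) ->
    (#|` F|)%:R <= B.
  move=> [S1 Sab] FS.
  have F1 (i : F) : dotp (val i) (val i) = 1.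
    have := S1 _ (FS _ (valP i)); rewrite /enorm => n1.
    by rewrite -(sqr_sqrtr (dotpp_ge0 _)) n1 expr1n.
  have Fab (i j : F) : i != j ->
      dotp (val i) (val j) = alpha \/ dotp (val i) (val j) = beta.
    by move=> ij; apply: Sab; [exact: FS (valP i)|exact: FS (valP j)|
      move/val_inj/eqP; rewrite (negbTE ij)].
  have := code_card _ F1 Fab hd hbeta1 hbeta0 halpha1 da.
  rewrite -cardfE le_max => -[nd|nT]; first by rewrite natr1 ler_nat nd.
  apply/orP; right.
  have -> : - alpha / (alpha - beta) + d%:R^-1 =
      (alpha - beta - d%:R * alpha) / (d%:R * (alpha - beta)).
    by field; lra.
  have -> : ((alpha - beta - d%:R * alpha) / (d%:R * (alpha - beta)))^-1
      * ((1 - beta) / (alpha - beta)) =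
      d%:R * (1 - beta) / (alpha - beta - d%:R * alpha).
    by field; lra.
  by rewrite ler_pdivlMr// subr_gt0.
apply: ge_ereal_sup => _ [S cS <-].
rewrite /counting; case: asboolP => [finS|infS].
  rewrite lee_fin; apply: (fset_le S) => // z.
  by rewrite in_fset_set// => /set_mem.
(* An infinite code would have a finite subset of at least [truncn B + 1 > B] points. *)
have [F FS] := infinite_set_fset (Num.truncn B).+1 infS.
move=> trF; have := fset_le S F cS FS.
rewrite leNgt (lt_le_trans (truncnS_gt B))//.
by rewrite ler_nat.
Qed.
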